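(* Let $K$ be a field. Given positive integers $s<m$, there exists a finite simple graph $G$ (without isolated vertices) with matching number $\nu(G)=m$ such that, for $1\le k\le m$, $g_{I(G)}(k)=0$ if and only if $k\in\{s+1,\dots,m\}$.
   Context: For a finite simple graph $G$ on vertex set $[n]=\{1,\dots,n\}$, the edge ideal $I(G)\subset S=K[x_1,\dots,x_n]$ is generated by all $x_ix_j$ with $\{i,j\}\in E(G)$. The matching number $\nu(G)$ is the maximum size of a set of pairwise disjoint edges of $G$. For a squarefree monomial ideal $I\subset S$ (nonzero, proper), the $k$th squarefree power $I^{[k]}$ is the monomial ideal of $S$ generated by the squarefree monomials belonging to $I^k$. The monomial grade $\nu(I)$ is the biggest length of a monomial regular sequence contained in $I$; equivalently $I^{[k]}\neq(0)$ if and only if $k\le\nu(I)$. One has $\nu(I(G))=\nu(G)$. For $1\le k\le \nu(I)$, $d_k=\mathrm{indeg}(I^{[k]})$ is the minimum degree of a monomial generator of $I^{[k]}$, and the normalized depth function of $I$ is $g_I(k)=\mathrm{depth}(S/I^{[k]})-(d_k-1)$ for $1\le k\le\nu(I)$ (this is always a non-negative integer). Thus for $I=I(G)$ one has $d_k=2k$. *)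

(* Defs.v *)
From HB Require Import structures.
From mathcomp Require Import all_boot all_order all_algebra.
From mathcomp.multinomials Require Import mpoly.

Set Implicit Arguments.
Unset Strict Implicit.
Unset Printing Implicit Defensive.

Import GRing.Theory.
Local Open Scope ring_scope.

(* Ideals are Prop-valued predicates: membership in an ideal generated by an
   arbitrary family is not given by a boolean test. *)
Section Ideals.
Variable R : comNzRingType.

Definition ideal_gen (A : R -> Prop) : R -> Prop := fun f =>
  exists2 s : seq (R * R),
    forall p, p \in s -> A p.2 & f = \sum_(p <- s) p.1 * p.2.

(* For k = 0 the only generator is the empty product 1. *)
Definition ideal_pow (I : R -> Prop) (k : nat) : R -> Prop :=
  ideal_gen (fun f => exists2 g : 'I_k -> R,
    forall i, I (g i) & f = \prod_(i < k) g i).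

(* J + (fs) *)
Definition ideal_adjoin (J : R -> Prop) (fs : seq R) : R -> Prop :=
  ideal_gen (fun f => J f \/ f \in fs).

(* fs is a regular sequence on R / J, expressed in R by lifting: each f_i is a
   nonzerodivisor on R / (J + (f_1, .., f_(i-1))), and J + (fs) is proper. *)
Definition regular_seq (J : R -> Prop) (fs : seq R) : Prop :=
  (forall fs1 f fs2, fs = fs1 ++ f :: fs2 ->
     forall h, ideal_adjoin J fs1 (f * h) -> ideal_adjoin J fs1 h)
  /\ ~ ideal_adjoin J fs 1.

(* d = grade(m, R / J): the largest length of an (R / J)-regular sequence
   contained in m. *)
Definition is_grade (m J : R -> Prop) (d : nat) : Prop :=
  (exists fs : seq R,
     [/\ forall f, f \in fs -> m f, regular_seq J fs & size fs = d])
  /\ (forall fs : seq R,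
     (forall f, f \in fs -> m f) -> regular_seq J fs -> (size fs <= d)%N).

End Ideals.

Section MonomialIdeals.
Variables (K : fieldType) (n : nat).
Notation S := {mpoly K[n]}.

Definition max_ideal : S -> Prop :=
  ideal_gen (fun f : S => exists i : 'I_n, f = 'X_i).

(* depth (S / J) = d, for J homogeneous *)
Definition is_depth (J : S -> Prop) (d : nat) : Prop := is_grade max_ideal J d.

Definition squarefree_mnm (a : 'X_{1..n}) : Prop := forall i, (a i <= 1)%N.

(* I^[k] *)
Definition squarefree_pow (I : S -> Prop) (k : nat) : S -> Prop :=
  ideal_gen (fun f : S => exists a : 'X_{1..n},
    [/\ squarefree_mnm a, ideal_pow I k 'X_[a] & f = 'X_[a]]).

(* 'X_[a] belongs to the unique minimal set of monomial generators of J. *)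
Definition min_generator (J : S -> Prop) (a : 'X_{1..n}) : Prop :=
  J 'X_[a] /\ (forall b : 'X_{1..n}, J 'X_[b] -> (b <= a)%MM -> b = a).

Definition is_indeg (J : S -> Prop) (d : nat) : Prop :=
  (exists2 a, min_generator J a & mdeg a = d)
  /\ (forall a, min_generator J a -> (d <= mdeg a)%N).

(* g_I(k) = g. Depth and initial degree are maxima and minima that may a priori
   fail to exist, so g_I is given by its graph; there is at most one such g
   (normalized_depth_uniq). *)
Definition normalized_depth (I : S -> Prop) (k : nat) (g : int) : Prop :=
  exists d e : nat,
    [/\ is_depth (squarefree_pow I k) d, is_indeg (squarefree_pow I k) e
      & g = d%:Z - (e%:Z - 1)].

Lemma normalized_depth_uniq I k g g' :
  normalized_depth I k g -> normalized_depth I k g' -> g = g'.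
Proof.
case=> d [e [[[s [ms rs <-]] ud] [[a ma <-] ue] ->]].
case=> d' [e' [[[s' [ms' rs' <-]] ud'] [[a' ma' <-] ue'] ->]].
have -> : size s = size s'.
  by apply/eqP; rewrite eqn_leq ud' // ud.
suff -> : mdeg a = mdeg a' by [].
by apply/eqP; rewrite eqn_leq ue // ue'.
Qed.

End MonomialIdeals.

Section Graphs.
Variable n : nat.

Record sgraph := SGraph {
  adj :> rel 'I_n;
  adj_sym : ssrbool.symmetric adj;
  adj_irr : irreflexive adj }.

Variable G : sgraph.

Definition no_isolated : Prop := forall x, exists y, G x y.

Definition edges : {set {set 'I_n}} :=
  [set [set p.1; p.2] | p : 'I_n * 'I_n & G p.1 p.2].

Definition matching (M : {set {set 'I_n}}) : bool :=
  (M \subset edges) && trivIset M.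

Definition matching_number : nat :=
  (\max_(M : {set {set 'I_n}} | matching M) #|M|)%N.

Definition edge_ideal (K : fieldType) : {mpoly K[n]} -> Prop :=
  ideal_gen (fun f : {mpoly K[n]} => exists i j, G i j /\ f = 'X_i * 'X_j).

End Graphs.

Arguments edge_ideal {n} G K _.

(* Main.v *)
Require Import Defs.
From HB Require Import structures.
From Stdlib Require Import Classical FunctionalExtensionality PropExtensionality.
From mathcomp Require Import all_boot all_order all_algebra.
From mathcomp Require Import ring zify.
From mathcomp.multinomials Require Import mpoly.

(** The graph is the disjoint union of [s] edges and of a complete graph on
    [2 (m - s)] vertices. Its [k]-th squarefree power is the Stanley-Reisner
    ideal of the complex whose faces are the vertex sets containing no
    [k]-matching ([squarefree_pow_edge_ideal]); all sets with fewer than [2k]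
    vertices are faces, and the initial degree is [2k]. So one has to show that
    the depth is [2k - 1] for [k > s] and at least [2k] for [k <= s].

    Lower bounds. One explicit sequence serves for all of them: the complete
    symmetric polynomials [h_1, .., h_r] in all the variables. A sequence that
    is weakly regular modulo [J : u] and modulo [J + (u)] is weakly regular
    modulo [J] ([wregular_colon]), so regularity can be checked by branching on
    variables until only ideals generated by variables are left. Their quotients
    are polynomial rings, on which [h_1, .., h_r] is regular as soon as there
    are at least [r] variables: up to earlier terms [h_i] is a polynomial with
    leading monomial a power of the [i]-th variable, and leading monomials that
    are pairwise coprime force regularity ([initial_gens_adjoin],
    [wregular_complete_sym]). If all sets of [r] vertices are faces, branching
    stops before fewer than [r] variables survive ([wregular_faces]); this gives
    [2k - 1] for every [k]. If [k <= s], branching along the isolated edges gains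
    one more: deleting an end of such an edge makes the other end a free
    variable, and keeping both ends of [k] of them yields the unit ideal
    ([wregular_isolated_edges]).

    Upper bounds. If [r] elements of the maximal ideal form a weakly regular
    sequence modulo [J], the Koszul homology of [S/J] vanishes in degrees above
    [n - r] ([wregular_koszul_exact]). The cycle [1] of degree [0] shows that the
    depth is at most [n], hence exists. For [k > s], the first [2k - 1] vertices,
    among which all ends of isolated edges, form a facet [F], since together with
    any further vertex they have a perfect matching. The cycle of Koszul degree
    [n - (2k - 1)] carried by [F] does not bound, so that the depth is at most
    [2k - 1] ([regular_seq_facet]). *)

Set Implicit Arguments.
Unset Strict Implicit.
Unset Printing Implicit Defensive.

Import Order.TTheory GRing.Theory.
Local Open Scope ring_scope.

(** * Weakly regular sequences *)

Section WeaklyRegular.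
Variable R : comNzRingType.
Implicit Types (J : R -> Prop) (f g h u : R) (fs : seq R).

Definition is_ideal J : Prop :=
  [/\ J 0, forall f g, J f -> J g -> J (f + g) & forall a f, J f -> J (a * f)].

Definition adjoin J f : R -> Prop := fun g => exists a, J (g - a * f).

Definition colon J u : R -> Prop := fun g => J (u * g).

(** Regularity of [fs] on [R / J], in a form suited to induction on [fs] and
    without the requirement that the quotient by [fs] be nonzero. *)
Fixpoint wregular J fs : Prop :=
  if fs is f :: fs' then
    (forall h, J (f * h) -> J h) /\ wregular (adjoin J f) fs'
  else True.

Lemma idealB J : is_ideal J -> forall f g, J f -> J g -> J (f - g).
Proof.
by case=> _ JD JM f g Jf Jg; rewrite -mulN1r; apply: JD => //; apply: JM.
Qed.

Lemma ideal_subl J : is_ideal J -> forall f g, J (f - g) -> J f -> J g.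
Proof.
by move=> JJ f g Jfg Jf; rewrite -[g](subKr f); apply: idealB.
Qed.

Lemma ideal_subr J : is_ideal J -> forall f g, J (f - g) -> J g -> J f.
Proof. by move=> [_ JD _] f g Jfg Jg; rewrite -[f](subrK g); apply: JD. Qed.

Lemma sub_adjoin J f : forall g, J g -> adjoin J f g.
Proof. by move=> g Jg; exists 0; rewrite mul0r subr0. Qed.

Lemma mem_adjoin J f : is_ideal J -> adjoin J f f.
Proof. by case=> J0 _ _; exists 1; rewrite mul1r subrr. Qed.

Lemma ideal_adjoin1 J f : is_ideal J -> is_ideal (adjoin J f).
Proof.
case=> J0 JD JM; split; first exact: sub_adjoin.
  move=> g h [a Ja] [b Jb]; exists (a + b).
  have -> : g + h - (a + b) * f = (g - a * f) + (h - b * f) by ring.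
  exact: JD.
move=> c g [a Ja]; exists (c * a).
have -> : c * g - c * a * f = c * (g - a * f) by ring.
exact: JM.
Qed.

Lemma eq_adjoin J J' f : (forall g, J g <-> J' g) ->
  forall g, adjoin J f g <-> adjoin J' f g.
Proof. by move=> eqJ g; split=> -[a]; exists a; apply/eqJ. Qed.

Lemma eq_wregular J J' fs : (forall g, J g <-> J' g) ->
  wregular J fs -> wregular J' fs.
Proof.
elim: fs J J' => //= f fs IH J J' eqJ [regf regfs]; split.
  by move=> h /eqJ/regf/eqJ.
by apply: (IH (adjoin J f)) => // g; apply: eq_adjoin.
Qed.

Lemma adjoinC J f g h :
  adjoin (adjoin J f) g h -> adjoin (adjoin J g) f h.
Proof. by move=> [a [b Jh]]; exists b, a; rewrite addrAC. Qed.

Lemma wregular_true J fs : (forall g, J g) -> wregular J fs.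
Proof.
elim: fs J => //= f fs IH J allJ; split=> //.
by apply: IH => g; apply: sub_adjoin.
Qed.

(** [0 -> R/(J:u) -> R/J -> R/(J+u) -> 0] is exact, and stays exact modulo an
    element regular on [R/(J+u)] (the snake lemma), which is what makes the
    induction on the sequence go through. *)
Lemma wregular_colon J u fs : is_ideal J ->
  wregular (colon J u) fs -> wregular (adjoin J u) fs -> wregular J fs.
Proof.
elim: fs J => //= f fs IH J JJ [regc wregc] [rega wrega].
have [J0 JD JM] := JJ.
have JB := idealB JJ; split=> [h Jfh|].
  have [a Ja] := rega h (sub_adjoin _ Jfh).
  have Jfa : colon J u (f * a).
    rewrite /colon; have -> : u * (f * a) = f * h - f * (h - a * u) by ring.
    by apply: JB => //; apply: JM.
  have := JD _ _ Ja (regc _ Jfa); rewrite [u * a]mulrC.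
  by rewrite subrK.
apply: IH; first exact: ideal_adjoin1.
  apply: eq_wregular wregc => g; split=> [[a Ja]|[a Ja]].
    exists (u * a); move: Ja; rewrite /colon.
    by have -> : u * (g - a * f) = u * g - u * a * f by ring.
  have [|b Jb] := rega a.
    exists g; have -> : f * a - g * u = - 1 * (u * g - a * f) by ring.
    exact: JM.
  exists b; rewrite /colon.
  have -> : u * (g - b * f) = (u * g - a * f) + f * (a - b * u) by ring.
  by apply: JD => //; apply: JM.
by apply: eq_wregular wrega => g; split; apply: adjoinC.
Qed.

Definition adjoins J fs := foldl adjoin J fs.

Lemma ideal_adjoins J fs : is_ideal J -> is_ideal (adjoins J fs).
Proof. by elim: fs J => //= f fs IH J JJ; apply/IH/ideal_adjoin1. Qed.

Lemma ideal_genP (A I : R -> Prop) :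
  is_ideal I -> (forall f, A f -> I f) -> forall f, ideal_gen A f -> I f.
Proof.
case=> I0 ID IM sAI _ [s sA ->]; rewrite big_seq.
by apply: (big_ind I) => [//||p ps]; [exact: ID|apply/IM/sAI/sA].
Qed.

Lemma ideal_ideal_gen (A : R -> Prop) : is_ideal (ideal_gen A).
Proof.
split; first by exists [::]; rewrite ?big_nil.
  move=> _ _ [s sA ->] [t tA ->]; exists (s ++ t); last by rewrite big_cat.
  by move=> p; rewrite mem_cat => /orP[/sA|/tA].
move=> a _ [s sA ->]; exists [seq (a * p.1, p.2) | p <- s].
  by move=> _ /mapP[p ps ->]; apply: (sA p).
by rewrite big_map mulr_sumr; apply: eq_bigr => p _; rewrite mulrA.
Qed.

Lemma mem_ideal_gen (A : R -> Prop) f : A f -> ideal_gen A f.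
Proof.
by move=> Af; exists [:: (1, f)] => [p|]; rewrite ?inE ?big_seq1 ?mul1r // => /eqP->.
Qed.

Lemma sub_adjoins J fs g : J g -> adjoins J fs g.
Proof. by elim: fs J => //= f fs IH J Jg; apply/IH/sub_adjoin. Qed.

Lemma mem_adjoins J fs f : is_ideal J -> f \in fs -> adjoins J fs f.
Proof.
elim: fs J => //= f' fs IH J JJ; rewrite inE => /orP[/eqP->|/IH].
  by apply/sub_adjoins/mem_adjoin.
by apply; apply: ideal_adjoin1.
Qed.

Lemma adjoins_min J fs (I : R -> Prop) : is_ideal I -> (forall g, J g -> I g) ->
  (forall f, f \in fs -> I f) -> forall g, adjoins J fs g -> I g.
Proof.
move=> II; have [_ ID IM] := II.
elim: fs J => //= f fs IH J sJI sfI; apply: IH => [g [a /sJI Ia]|h hfs].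
  by apply: (ideal_subr II Ia); apply/IM/sfI/mem_head.
by apply: sfI; rewrite inE hfs orbT.
Qed.

Lemma ideal_adjoinE J fs g : is_ideal J -> ideal_adjoin J fs g <-> adjoins J fs g.
Proof.
move=> JJ; split.
  apply: ideal_genP; first exact: ideal_adjoins.
  by move=> f []; [apply: sub_adjoins|apply: mem_adjoins].
apply: adjoins_min; first exact: ideal_ideal_gen.
  by move=> f Jf; apply: mem_ideal_gen; left.
by move=> f Jf; apply: mem_ideal_gen; right.
Qed.

Lemma wregularP J fs : wregular J fs <->
  (forall fs1 f fs2, fs = fs1 ++ f :: fs2 ->
     forall h, adjoins J fs1 (f * h) -> adjoins J fs1 h).
Proof.
split; elim: fs J => [|f fs IH] J.
- by move=> _ [].
- case=> regf regfs [|f1 fs1] g fs2 [<- eqfs] //.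
  exact: (IH _ regfs fs1 g fs2).
- by [].
- move=> H; split=> [|/=]; first exact: (H [::] f fs).
  by apply: IH => fs1 g fs2 eqfs h; apply: (H (f :: fs1) g fs2); rewrite eqfs.
Qed.

Lemma regular_seqE J fs : is_ideal J ->
  regular_seq J fs <-> wregular J fs /\ ~ adjoins J fs 1.
Proof.
move=> JJ; have AE := fun fs g => ideal_adjoinE fs g JJ.
split=> -[reg proper]; split.
- by apply/wregularP => fs1 f fs2 eqfs h /AE; move/(reg _ _ _ eqfs)/AE.
- by move=> /AE.
- move=> fs1 f fs2 eqfs h /AE.
  by move/wregularP: reg => /(_ _ _ _ eqfs h) reg /reg/AE.
- by move=> /AE.
Qed.

End WeaklyRegular.

(** * Initial ideals and regularity *)

Section InitialIdeals.
Variables (K : fieldType) (n : nat).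
Notation S := {mpoly K[n]}.
Implicit Types (J : S -> Prop) (f g h : S) (m : 'X_{1..n}) (ms : seq 'X_{1..n}).

Definition reducible ms m := has (fun m' => (m' <= m)%MM) ms.

Definition initial_gens J ms : Prop :=
  (forall m, m \in ms -> exists f, [/\ J f, f != 0 & mlead f = m])
  /\ (forall g, J g -> g != 0 -> reducible ms (mlead g)).

Definition disjoint_mnm m m' : bool := [forall i, (m i == 0%N) || (m' i == 0%N)].

Lemma disjoint_mnm_le m m' a : disjoint_mnm m m' ->
  (m' <= m + a)%MM = (m' <= a)%MM.
Proof.
move=> /forallP dis; apply/mnm_lepP/mnm_lepP => le i; have := le i; rewrite mnmDE.
  by case/orP: (dis i) => /eqP->.
by move=> /leq_trans; apply; rewrite leq_addl.
Qed.

Lemma reducible_addl ms m a : all (disjoint_mnm m) ms ->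
  reducible ms (m + a) = reducible ms a.
Proof.
move=> /allP dis; apply: eq_in_has => m' /dis; exact: disjoint_mnm_le.
Qed.

(** Division with remainder, carried out on leading terms only: the leading
    monomial of the remainder is irreducible, the others need not be. *)
Lemma lead_reduce J ms : is_ideal J -> initial_gens J ms ->
  forall h, exists h', J (h - h') /\ (h' = 0 \/ ~~ reducible ms (mlead h')).
Proof.
move=> [J0 JD JM] [gens _]; elim/mleadrect=> h IH.
have [/hasP[m /gens[f [Jf nzf <-]] le]|] := boolP (reducible ms (mlead h)); last first.
  by exists h; rewrite subrr; split=> //; right.
have [->|nzh] := eqVneq h 0; first by exists 0; rewrite subrr; split=> //; left.
pose c := mleadc h / mleadc f; pose t := c *: 'X_[mlead h - mlead f] * f.
have nzc : c != 0 by rewrite mulf_neq0 ?invr_eq0 ?mleadc_eq0.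
have nzX : 'X_[mlead h - mlead f] != 0 :> S.
  by rewrite -mleadc_eq0 mleadXm mcoeffX eqxx oner_neq0.
have Jt : J t by apply: JM.
have lt : mlead t = mlead h.
  by rewrite mleadM ?mleadZ ?mleadXm ?submK // scaler_eq0 (negbTE nzc).
have ct : t@_(mlead h) = mleadc h.
  rewrite -[in LHS](submK le) /t -scalerAl mcoeffZ mulrC [_ * f]mulrC.
  by rewrite mcoeffMX mulrC divfK // mleadc_eq0.
have [e|nz] := eqVneq (h - t) 0.
  by exists 0; split; [rewrite subr0 (subr0_eq e)|left].
have [|h' [Jh' red]] := IH (h - t).
  rewrite lt_neqAle; apply/andP; split; last first.
    by have := mleadB_le h t; rewrite lt joinxx.
  apply: contra_neq nz => e; apply/eqP; rewrite -mleadc_eq0 e mcoeffB ct.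
  by rewrite subrr.
exists h'; split=> //.
have -> : h - h' = (h - t - h') + t by ring.
exact: JD.
Qed.

(** A leading monomial coprime to the initial ideal of [J] makes an element
    regular on [S/J], and the initial ideal of [J + (f)] is the expected one:
    reduced representatives rule out any cancellation. *)
Lemma initial_gens_adjoin J ms f f' : is_ideal J -> initial_gens J ms ->
  J (f - f') -> f' != 0 -> all (disjoint_mnm (mlead f')) ms ->
  (forall h, J (f * h) -> J h) /\ initial_gens (adjoin J f) (mlead f' :: ms).
Proof.
move=> JJ gJ Jff' nzf' dis; have [J0 JD JM] := JJ.
have [gens init] := gJ.
have red_mul a : a != 0 -> ~~ reducible ms (mlead a) ->
    ~~ reducible ms (mlead (a * f')).
  by move=> nza; rewrite mleadM // addmC reducible_addl.
split=> [h Jfh|].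
  have [h' [Jhh' red]] := lead_reduce JJ gJ h.
  apply: (ideal_subr JJ Jhh'); case: red => [->//|red].
  have [->//|nzh'] := eqVneq h' 0.
  have Jfh' : J (h' * f').
    have -> : h' * f' = f * h - f * (h - h') - h' * (f - f') by ring.
    by apply: idealB => //; [apply: idealB => //|]; apply: JM.
  have := red_mul _ nzh' red; rewrite init //.
  by rewrite mulf_neq0.
split=> [m|g [a Ja] nzg].
  rewrite inE => /orP[/eqP->|/gens[g [Jg nzg <-]]].
    exists f'; split=> //; exists 1; rewrite mul1r -opprB -mulN1r; exact: JM.
  by exists g; split=> //; apply: sub_adjoin.
have [a' [Jaa' red]] := lead_reduce JJ gJ a.
pose b := g - a' * f'.
have Jb : J b.
  have -> : b = (g - a * f) + f * (a - a') + a' * (f - f') by rewrite /b; ring.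
  by apply: (JD); [apply: JD|] => //; apply: JM.
have eg : g = b + a' * f' by rewrite subrK.
case: red => [a0|red].
  by rewrite /reducible /= -/(reducible _ _) init ?orbT // eg a0 mul0r addr0.
have [a0|nza] := eqVneq a' 0.
  by rewrite /reducible /= -/(reducible _ _) init ?orbT // eg a0 mul0r addr0.
have lea : (mlead f' <= mlead (a' * f'))%MM by rewrite mleadM // lem_addl.
have [b0|nzb] := eqVneq b 0; first by rewrite eg b0 add0r /reducible /= lea.
have redb := init _ Jb nzb; have redaf := red_mul _ nza red.
have ne : mlead b != mlead (a' * f') by apply: contraNneq redaf => <-.
rewrite eg mleadD // /reducible /= -/(reducible _ _).
by case: leP; rewrite ?lea ?redb ?orbT.
Qed.

End InitialIdeals.

(** * Complete symmetric polynomials *)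

Section CompleteSymmetric.
Variables (K : fieldType) (n : nat).
Notation S := {mpoly K[n]}.
Implicit Types (J : S -> Prop) (L : seq 'I_n).

(** The complete homogeneous symmetric polynomials in the variables of [L]:
    a monomial either avoids the first variable or is divisible by it. *)
Fixpoint complete_sym L : nat -> S :=
  if L is v :: L' then
    fix hv i := if i is i'.+1 then complete_sym L' i'.+1 + 'X_v * hv i' else 1
  else fun i => (i == 0%N)%:R.

Lemma complete_sym0 L : complete_sym L 0 = 1.
Proof. by case: L. Qed.

Lemma complete_symS v L i :
  complete_sym (v :: L) i.+1 = complete_sym L i.+1 + 'X_v * complete_sym (v :: L) i.
Proof. by []. Qed.

Lemma msupp_complete_sym L i a : a \in msupp (complete_sym L i) ->
  mdeg a = i /\ (forall j, a j != 0%N -> j \in L).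
Proof.
elim: L i a => [|v L IHL] i a.
  case: i => [|i] /=; last by rewrite msupp0.
  rewrite msupp1 inE => /eqP->; split; first exact: mdeg0.
  by move=> j; rewrite mnm0E.
elim: i a => [|i IHi] a.
  rewrite complete_sym0 msupp1 inE => /eqP->; split; first exact: mdeg0.
  by move=> j; rewrite mnm0E.
rewrite complete_symS => /msuppD_le; rewrite mem_cat => /orP[/IHL[-> sub]|].
  by split=> // j /sub; rewrite inE orbC => ->.
rewrite mulrC (perm_mem (msuppMX _ _)) => /mapP[b /IHi[db sub] ->].
rewrite mdegD mdeg1 db; split=> // j; rewrite mnmDE mnm1E.
by have [<-|_ /sub //] := eqVneq v j; rewrite inE eqxx.
Qed.

(** In the order of the variables on an increasing list, the power of the
    first variable dominates every other monomial of its degree. *)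
Lemma mlead_complete_sym v L i : sorted ltn [seq val j | j <- v :: L] ->
  complete_sym (v :: L) i != 0 /\ mlead (complete_sym (v :: L) i) = (U_(v) *+ i)%MM.
Proof.
move=> sorted_vL.
have ltvL j : j \in L -> (v < j)%N.
  move=> jL; move: sorted_vL => /=; rewrite (path_sortedE ltn_trans).
  by case/andP=> /allP/(_ (val j)) + _; apply; apply: map_f.
have lead1 : (complete_sym (v :: L) i)@_(U_(v) *+ i) = 1.
  elim: i => [|i IHi]; first by rewrite complete_sym0 mulm0n mcoeff1 eqxx.
  rewrite complete_symS mcoeffD mulmS mulrC mcoeffMX IHi memN_msupp_eq0 ?add0r //.
  apply/negP => /msupp_complete_sym[_ /(_ v)].
  by rewrite mnmDE mnm1E eqxx => /(_ isT) /ltvL; rewrite ltnn.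
have supp : (U_(v) *+ i)%MM \in msupp (complete_sym (v :: L) i).
  by rewrite mcoeff_msupp lead1 oner_neq0.
have nz : complete_sym (v :: L) i != 0.
  by apply: contraTneq supp => ->; rewrite msupp0.
split=> //; apply/le_anti; rewrite (msupp_le_mlead supp) andbT.
have := mlead_supp nz; set a := mlead _ => /msupp_complete_sym[da sub].
rewrite le_eqVlt; case: (eqVneq a _) => //= ne.
have dU : mdeg (U_(v) *+ i)%MM = i by rewrite mdegMn mdeg1 mul1n.
have rest : ((a v) + \sum_(j | j != v) a j = i)%N.
  by rewrite -da mdegE [RHS](bigD1 v).
apply/ltmcP; first by rewrite dU.
exists v => [j ltjv|].
  rewrite mulmnE mnm1E; have [e|_] := eqVneq v j; first by rewrite e ltnn in ltjv.
  rewrite mul0n; apply/eqP; apply: contraTT ltjv => /sub.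
  by rewrite inE -leqNgt => /orP[/eqP->|/ltvL/ltnW].
rewrite mulmnE mnm1E eqxx mul1n ltn_neqAle -{2}rest leq_addr andbT.
apply: contra_neq ne => avi; apply/mnmP => j; rewrite mulmnE mnm1E.
have [<-|nej] := eqVneq v j; first by rewrite mul1n.
move/eqP: rest; rewrite avi -[X in _ == X]addn0 eqn_add2l sum_nat_eq0.
by move/forallP/(_ j); rewrite eq_sym nej mul0n => /eqP.
Qed.

(** The difference [h_(a+1)(v, L) - h_(a+1)(L)] is [x_v h_a(v, L)], so each
    deleted variable costs one of the [h_j] that are known to be in [J]. *)
Lemma complete_sym_drop J L b c a : is_ideal J ->
  (forall j, (c < j <= a)%N -> J (complete_sym L j)) -> (b + c <= a)%N ->
  J (complete_sym L a.+1 - complete_sym (drop b L) a.+1).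
Proof.
move=> JJ; have [J0 JD JM] := JJ.
elim: b L c => [|b IH] L c JL le; first by rewrite drop0 subrr.
case: L JL => [|v L] JL; first by rewrite subrr.
have -> : complete_sym (v :: L) a.+1 - complete_sym (drop b.+1 (v :: L)) a.+1 =
    'X_v * complete_sym (v :: L) a
    + (complete_sym L a.+1 - complete_sym (drop b L) a.+1).
  by rewrite complete_symS /=; ring.
apply: (JD); first by apply/JM/JL; lia.
apply: (IH L c.+1); last by lia.
case=> // j le'; have -> : complete_sym L j.+1 =
    complete_sym (v :: L) j.+1 - 'X_v * complete_sym (v :: L) j.
  by rewrite complete_symS addrK.
by apply: idealB => //; [apply: JL|apply/JM/JL]; lia.
Qed.

(** Modulo [h_1, .., h_a] in all the variables, [h_(a+1)] may be computed
    without the first [a] variables; its leading monomial is then a pure power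
    of a variable that has not occurred yet. *)
Lemma wregular_complete_sym (theta : nat -> S) L J ms a c :
  is_ideal J -> initial_gens J ms -> sorted ltn [seq val j | j <- L] ->
  (a + c <= size L)%N -> (forall j, J (theta j - complete_sym L j)) ->
  (forall j, (0 < j <= a)%N -> J (theta j)) ->
  (forall v m, v \in drop a L -> m \in ms -> m v = 0%N) ->
  wregular J [seq theta j | j <- iota a.+1 c].
Proof.
elim: c a J ms => // c IH a J ms JJ gJ sortedL size_L thetaL Jtheta disj.
have [J0 JD JM] := JJ.
have lt_aL : (a < size L)%N by lia.
have [v0 v0L] : exists v0, v0 \in L.
  by case: (L) lt_aL => // v ? _; exists v; rewrite inE eqxx.
pose v := nth v0 L a.
have eL : drop a L = v :: drop a.+1 L by rewrite (drop_nth v0).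
have sorted_v : sorted ltn [seq val j | j <- v :: drop a.+1 L].
  by rewrite -eL map_drop drop_sorted.
have [nz lead] := mlead_complete_sym a.+1 sorted_v.
rewrite -eL in nz lead.
have JL j : (0 < j <= a)%N -> J (complete_sym L j).
  by move=> /Jtheta; apply: (ideal_subl JJ (thetaL j)).
have [||reg gJ'] := initial_gens_adjoin JJ gJ (f := theta a.+1) _ nz.
- have -> : theta a.+1 - complete_sym (drop a L) a.+1 =
      (theta a.+1 - complete_sym L a.+1)
    + (complete_sym L a.+1 - complete_sym (drop a L) a.+1) by ring.
  by apply: JD; [apply: thetaL|apply: complete_sym_drop JL _; rewrite ?addn0].
- apply/allP => m mms; apply/forallP => i; rewrite lead mulmnE mnm1E.
  by have [<-|] := eqVneq v i; rewrite ?(disj v m) ?orbT // eL inE eqxx.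
split=> //=; apply: IH gJ' _ _ _ _ _ => //.
- exact: ideal_adjoin1.
- by rewrite addSnnS.
- by move=> j; apply/sub_adjoin/thetaL.
- move=> j; rewrite [(j <= a.+1)%N]leq_eqVlt.
  have [-> _|/= _ /Jtheta] := eqVneq j a.+1; first exact: mem_adjoin.
  exact: sub_adjoin.
- move=> w m wL; rewrite inE => /orP[/eqP->|]; last first.
    by apply: disj; rewrite eL inE wL orbT.
  rewrite lead mulmnE mnm1E; have [e|] := eqVneq v w; last by [].
  move: sorted_v; rewrite /= (path_sortedE ltn_trans) => /andP[/allP/(_ (val w))].
  by rewrite e ltnn map_f // => /(_ isT).
Qed.

Lemma max_ideal_complete_sym L i : (0 < i)%N -> max_ideal (complete_sym L i).
Proof.
have [M0 MD MM] := ideal_ideal_gen (fun f : S => exists i : 'I_n, f = 'X_i).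
case: i => // i _; elim: L i => [|v L IHL] i; first exact: M0.
rewrite complete_symS; apply: MD; first exact: IHL.
by rewrite mulrC; apply/MM/mem_ideal_gen; exists v.
Qed.

End CompleteSymmetric.

(** * Squarefree monomial ideals *)

Section SquarefreeMonomialIdeals.
Variables (K : fieldType) (n : nat).
Notation S := {mpoly K[n]}.
Implicit Types (J : S -> Prop) (N : pred {set 'I_n}) (A B C D F : {set 'I_n}).

Definition msupport (a : 'X_{1..n}) : {set 'I_n} := [set i | a i != 0%N].

Definition upclosed N : Prop := forall A B, A \subset B -> N A -> N B.

(** [N] singles out the nonfaces of a simplicial complex, and the ideal is its
    Stanley-Reisner ideal. *)
Definition mono_ideal N (f : S) : Prop := forall a, a \in msupp f -> N (msupport a).

Definition meets D : pred {set 'I_n} := fun A => A :&: D != set0.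

Lemma msupportD a b : msupport (a + b) = msupport a :|: msupport b.
Proof. by apply/setP => i; rewrite !inE mnmDE addn_eq0 negb_and. Qed.

Lemma msupportU i : msupport U_(i) = [set i].
Proof. by apply/setP => j; rewrite !inE mnm1E eqb0 negbK eq_sym. Qed.

Lemma msupport0 : msupport 0%MM = set0.
Proof. by apply/setP => j; rewrite !inE mnm0E. Qed.

Lemma ideal_mono N : upclosed N -> is_ideal (mono_ideal N).
Proof.
move=> upN; split; first by move=> a; rewrite msupp0.
  by move=> f g Jf Jg a /msuppD_le; rewrite mem_cat => /orP[/Jf|/Jg].
move=> c f Jf a /msuppM_le/allpairsP[[x y] [/= xc yf ->]].
by apply: upN (Jf _ yf); rewrite msupportD subsetUr.
Qed.

Lemma mem_mono_ideal N a : mono_ideal N 'X_[a] <-> N (msupport a).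
Proof.
split=> [|Na b]; first by apply; rewrite msuppX mem_head.
by rewrite msuppX inE => /eqP->.
Qed.

Lemma eq_mono_ideal N N' : N =1 N' -> forall f, mono_ideal N f <-> mono_ideal N' f.
Proof. by move=> eqN f; split=> Nf a /Nf; rewrite eqN. Qed.

Lemma ideal_sum (R : comNzRingType) (I : R -> Prop) T (s : seq T) (P : pred T)
    (F : T -> R) :
  is_ideal I -> (forall i, P i -> I (F i)) -> I (\sum_(i <- s | P i) F i).
Proof. by case=> I0 ID _ IF; apply: (big_ind I) => //; apply: ID. Qed.

Lemma colon_mono N v f :
  colon (mono_ideal N) 'X_v f <-> mono_ideal (fun A => N (v |: A)) f.
Proof.
have E a : (U_(v) + a)%MM \in msupp ('X_v * f) = (a \in msupp f).
  by rewrite mulrC !mcoeff_msupp mcoeffMX.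
split=> Nf a.
  by rewrite -E => /Nf; rewrite msupportD msupportU.
rewrite mulrC (perm_mem (msuppMX _ _)) => /mapP[b /Nf Nb ->].
by rewrite msupportD msupportU.
Qed.

Lemma adjoin_mono N v f : upclosed N ->
  adjoin (mono_ideal N) 'X_v f <-> mono_ideal (fun A => N A || (v \in A)) f.
Proof.
move=> upN; have II := ideal_mono upN.
split=> [[a Na]|Nf].
  have upN' : upclosed (fun A => N A || (v \in A)).
    by move=> A B sAB /orP[/(upN _ _ sAB)->|/(subsetP sAB)->]; rewrite ?orbT.
  have II' := ideal_mono upN'; have [_ _ IM] := II'.
  apply: (ideal_subr II' (g := a * 'X_v)); first by move=> b /Na ->.
  by apply/IM/mem_mono_ideal; rewrite msupportU set11 orbT.
exists (\sum_(m <- msupp f | m v != 0%N) f@_m *: 'X_[m - U_(v)]).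
rewrite {1}[f]mpolyE (bigID (fun m : 'X_{1..n} => m v != 0%N)) /=.
rewrite mulr_suml addrAC -sumrB big1 ?add0r => [|m mv]; last first.
  by rewrite -scalerAl -mpolyXD submK ?subrr // lep1mP.
rewrite big_seq_cond; apply: ideal_sum => // m /andP[/Nf Nm mv].
rewrite -mul_mpolyC; have [_ _] := II; apply; apply/mem_mono_ideal.
by move: Nm; rewrite inE (negbTE mv) orbF.
Qed.

Lemma eq_wregular_mono N N' (fs : seq S) : N =1 N' ->
  wregular (mono_ideal N) fs -> wregular (mono_ideal N') fs.
Proof. by move=> eqN; apply/eq_wregular/eq_mono_ideal. Qed.

(** Passing to the link and to the deletion of the vertex [v]. *)
Lemma wregular_branch N v (fs : seq S) : upclosed N ->
  wregular (mono_ideal (fun A => N (v |: A))) fs ->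
  wregular (mono_ideal (fun A => N A || (v \in A))) fs ->
  wregular (mono_ideal N) fs.
Proof.
move=> upN link del; apply: (wregular_colon (u := 'X_v)); first exact: ideal_mono.
  by apply: eq_wregular link => f; rewrite colon_mono.
by apply: eq_wregular del => f; rewrite adjoin_mono.
Qed.

Lemma complete_sym_filter J D (L : seq 'I_n) j : is_ideal J ->
  (forall v, v \in D -> J 'X_v) ->
  J (complete_sym K L j - complete_sym K [seq v <- L | v \notin D] j).
Proof.
move=> [J0 JD JM] JX.
elim: L j => [|v L IHL] j; first by rewrite subrr.
case: j => [|j]; first by rewrite !complete_sym0 subrr.
have [vD|vD] := boolP (v \in D);
  rewrite /filter -/(filter _ _) ?vD ?(negbTE vD) /=.
  rewrite -/(complete_sym _ (v :: L)) addrAC; apply: JD; first exact: IHL.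
  by rewrite mulrC; apply/JM/JX.
elim: j => [|j IHj].
  have -> : forall a b c : S, a + c * 1 - (b + c * 1) = a - b by move=> *; ring.
  exact: IHL.
set a := complete_sym _ L _; set b := complete_sym _ (filter _ _) _.
have -> : forall x y c : S, a + c * x - (b + c * y) = (a - b) + c * (x - y).
  by move=> *; ring.
by apply: JD; [apply: IHL|apply: JM].
Qed.

Definition complete_syms r : seq S :=
  [seq complete_sym K (enum 'I_n) j | j <- iota 1 r].

Lemma disjointsU1 v A B : [disjoint v |: A & B] = (v \notin B) && [disjoint A & B].
Proof. by rewrite -!setI_eq0 setIUl setU_eq0 setI_eq0 disjoints1. Qed.

Lemma upclosed_meets D : upclosed (meets D).
Proof.
move=> A B sAB /set0Pn[i iAD]; apply/set0Pn; exists i.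
by apply: subsetP iAD; apply: setSI.
Qed.

Lemma wregular_meets D r : (#|D| + r <= n)%N ->
  wregular (mono_ideal (meets D)) (complete_syms r).
Proof.
move=> le_n; have II := ideal_mono (@upclosed_meets D).
pose L := [seq v <- enum 'I_n | v \notin D].
pose ms := [seq U_(v)%MM : 'X_{1..n} | v <- enum D].
have XD v : v \in D -> mono_ideal (meets D) 'X_v.
  move=> vD; apply/mem_mono_ideal/set0Pn; exists v.
  by rewrite msupportU !inE eqxx.
have gens : initial_gens (mono_ideal (meets D)) ms.
  split=> [m /mapP[v]|g Dg nzg].
    rewrite mem_enum => /XD XDv ->; exists 'X_v; split; rewrite ?mleadXm //.
    by rewrite -mleadc_eq0 mleadXm mcoeffX eqxx oner_neq0.
  have /set0Pn[v] := Dg _ (mlead_supp nzg); rewrite !inE => /andP[av vD].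
  apply/hasP; exists U_(v)%MM; last by rewrite lep1mP.
  by apply: map_f; rewrite mem_enum.
apply: (@wregular_complete_sym K n (complete_sym K (enum 'I_n)) L _ ms) => //.
- have : subseq [seq val j | j <- L] [seq val j | j <- enum 'I_n].
    exact/map_subseq/filter_subseq.
  by move=> /(subseq_sorted ltn_trans); apply; rewrite val_enum_ord iota_ltn_sorted.
- have -> : size L = #|~: D|.
    have /card_uniqP <- : uniq L by rewrite filter_uniq ?enum_uniq.
    apply: eq_card => v.
    by rewrite mem_filter mem_enum !inE andbT.
  by rewrite cardsCs setCK card_ord; lia.
- by move=> j; apply: complete_sym_filter.
- by case.
- move=> v m; rewrite drop0 mem_filter => /andP[vD _] /mapP[w].
  rewrite mem_enum => wD ->; rewrite mnm1E; case: eqVneq => // e.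
  by rewrite -e wD in vD.
Qed.

(** Deletions (sums with a variable) and links (colons by a variable) reduce
    the ring to polynomial rings on complements of the sets [D] of deleted
    variables. Once only [r] variables survive, they form a face, so that no
    polynomial ring in fewer than [r] variables ever shows up. *)
Lemma wregular_faces N r C D : upclosed N -> [disjoint C & D] ->
  (#|D| + r <= n)%N ->
  (forall F, C \subset F -> [disjoint F & D] -> #|F| = r -> ~~ N F) ->
  wregular (mono_ideal (fun A => N (A :|: C) || meets D A)) (complete_syms r).
Proof.
move=> upN; have [k] := ubnP #|~: (C :|: D)|.
elim: k C D => // k IH C D ltk disj le_n faces.
have upCD : upclosed (fun A => N (A :|: C) || meets D A).
  move=> A B sAB /orP[NA|/(upclosed_meets sAB)->]; last by rewrite orbT.
  by rewrite (upN _ _ _ NA) // setSU.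
(* If the complement of [D] is a face, all the generators that survive the
   deletion of [D] are variables of [D]. *)
have [ND|ND] := boolP (N (~: D)); last first.
  apply: (eq_wregular_mono (N := meets D)); last exact: wregular_meets.
  move=> A; case: (boolP (meets D A)); rewrite ?orbT ?orbF //.
  rewrite /meets negbK setI_eq0 => disjA; apply/esym/negbTE.
  apply: contra ND; apply: upN; rewrite subUset -!disjoints_subset.
  by rewrite disjA disj.
have [v vCD|CD] := pickP (mem (~: (C :|: D))); last first.
  apply: wregular_true => f a _; rewrite (upN _ _ _ ND) //.
  apply/subsetP => i; have := CD i; rewrite !inE => /negbFE.
  by case: (i \in D); rewrite ?orbF // => ->; rewrite orbT.
have /norP[vC vD] : ~~ ((v \in C) || (v \in D)) by move: vCD; rewrite !inE.
have ltn : (#|D| + r < n)%N.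
  rewrite ltn_neqAle le_n andbT; apply: contraL ND => /eqP e; apply: faces.
  - by rewrite -disjoints_subset.
  - by rewrite disjoints_subset.
  - by rewrite cardsCs setCK card_ord; lia.
have ltk' (X : {set 'I_n}) : v \in X -> C :|: D \subset X -> (#|~: X| < k)%N.
  move=> vX sX; rewrite -ltnS; apply: leq_trans ltk; rewrite ltnS.
  apply: proper_card; rewrite properE setCS sX; apply/subsetPn; exists v => //.
  by rewrite inE vX.
apply: (wregular_branch (v := v)) => //.
  apply: (eq_wregular_mono (N := fun A => N (A :|: (v |: C)) || meets D A)).
    move=> A /=; rewrite setUCA setUA; congr (_ || _).
    by rewrite /meets setIUl [[set v] :&: D]disjoint_setI0 ?set0U // disjoints1.
  apply: IH.
  - by apply: ltk'; rewrite ?inE ?eqxx // -setUA subsetUr.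
  - by rewrite disjointsU1 vD.
  - by [].
  - by move=> F; rewrite subUset => /andP[_ /faces].
apply: (eq_wregular_mono (N := fun A => N (A :|: C) || meets (v |: D) A)).
  move=> A /=; rewrite -orbA; congr (_ || _).
  rewrite /meets setIUr setU_eq0 negb_and orbC; congr (_ || _).
  by rewrite setI_eq0 disjoint_sym disjoints1 negbK.
apply: IH.
- by apply: ltk'; rewrite ?inE ?eqxx ?orbT // setUCA subsetUr.
- by rewrite disjoint_sym disjointsU1 vC disjoint_sym.
- by rewrite cardsU1 vD.
- move=> F sCF; rewrite disjoint_sym disjointsU1 disjoint_sym => /andP[_].
  exact: faces.
Qed.

Lemma max_ideal_coeff0 (f : S) : max_ideal f -> f@_0%MM = 0.
Proof.
apply: (@ideal_genP _ _ (fun f : S => f@_0%MM = 0)); last first.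
  by move=> _ [i ->]; rewrite mcoeffX mnm1_eq0.
split=> [|g h g0 h0|a g g0]; first exact: mcoeff0.
  by rewrite mcoeffD g0 h0 addr0.
by rewrite rmorphM /= g0 mulr0.
Qed.

Lemma proper_adjoins_mono N (fs : seq S) : upclosed N -> ~~ N set0 ->
  (forall f, f \in fs -> max_ideal f) -> ~ adjoins (mono_ideal N) fs 1.
Proof.
move=> upN N0 mfs.
suff : forall g, adjoins (mono_ideal N) fs g -> g@_0%MM = 0.
  by move=> H /H; rewrite mcoeff1 eqxx => /eqP; rewrite oner_eq0.
apply: adjoins_min => [|g Ng|f /mfs /max_ideal_coeff0 //].
  split=> [|g h g0 h0|a g g0]; first exact: mcoeff0.
    by rewrite mcoeffD g0 h0 addr0.
  by rewrite rmorphM /= g0 mulr0.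
by apply: contraNeq N0; rewrite -mcoeff_msupp => /Ng; rewrite msupport0.
Qed.

End SquarefreeMonomialIdeals.

(** * Koszul complexes and upper bounds on depth *)

Section Koszul.
Variables (R : comNzRingType) (n : nat) (x : 'I_n -> R).
Implicit Types (c y z w : {set 'I_n} -> R) (i j : 'I_n) (A B : {set 'I_n}).

Definition koszul_sign i A : R := (-1) ^+ #|[set j in A | (j < i)%N]|.

(** Elements of the Koszul complex of [x] are families [c] of coefficients on the
    basis of the exterior algebra indexed by subsets of [{0, .., n - 1}]. *)
Definition koszul_diff c : {set 'I_n} -> R :=
  fun A => \sum_(i | i \notin A) koszul_sign i A * x i * c (i |: A).

Definition koszul_mul i c : {set 'I_n} -> R :=
  fun A => if i \in A then koszul_sign i (A :\ i) * c (A :\ i) else 0.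

Definition has_degree d c : Prop := forall A, #|A| != d -> c A = 0.

Lemma koszul_sign_sqr i A : koszul_sign i A * koszul_sign i A = 1.
Proof. by rewrite -expr2 sqrr_sign. Qed.

Lemma koszul_signU1 i j A : j \notin A ->
  koszul_sign i (j |: A) = koszul_sign i A * (-1) ^+ (j < i)%N.
Proof.
move=> jA; rewrite -exprD; congr (_ ^+ _); rewrite addnC.
have -> : [set k in j |: A | (k < i)%N] =
    (if (j < i)%N then [set j] else set0) :|: [set k in A | (k < i)%N].
  apply/setP => k; rewrite !inE; case: ifP => lt; rewrite !inE.
    by have [->|] := eqVneq k j; rewrite ?lt.
  by have [->|] := eqVneq k j; rewrite ?lt ?andbF.
case: ifP => lt; last by rewrite set0U.
by rewrite cardsU1 !inE (negbTE jA).
Qed.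

Lemma sign_ltn i j : i != j -> (-1) ^+ (i < j)%N * (-1) ^+ (j < i)%N = -1 :> R.
Proof.
rewrite -val_eqE /=; case: ltngtP => // _ _; rewrite ?mulr1 ?mul1r //.
Qed.

Lemma antisymmetric_sum (G : 'I_n -> 'I_n -> R) :
  (forall i, G i i = 0) -> (forall i j, G i j = - G j i) ->
  \sum_i \sum_j G i j = 0.
Proof.
move=> G0 GN.
have -> : \sum_i \sum_j G i j =
    \sum_(i < n) \sum_(j < n | (i < j)%N) G i j
    + \sum_(i < n) \sum_(j < n | (j < i)%N) G i j.
  rewrite -big_split; apply: eq_bigr => i _ /=.
  rewrite (bigID (fun j : 'I_n => (i < j)%N)) /=; congr (_ + _).
  rewrite (bigD1 i) ?ltnn //= G0 add0r; apply: eq_bigl => j.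
  by rewrite -leqNgt andbC -val_eqE /= -ltn_neqAle.
rewrite [X in _ + X](exchange_big_dep predT) //= -big_split big1 //= => i _.
by rewrite -big_split big1 //= => j _; rewrite [G i j]GN addNr.
Qed.

Lemma koszul_diffK c A : koszul_diff (koszul_diff c) A = 0.
Proof.
pose G i j : R := if (i \notin A) && (j \notin A) && (i != j) then
  koszul_sign i A * x i * (koszul_sign j (i |: A) * x j * c (j |: (i |: A))) else 0.
rewrite -[RHS](antisymmetric_sum (G := G)).
- rewrite /koszul_diff big_mkcond; apply: eq_bigr => i _.
  rewrite mulr_sumr big_mkcond /G; case: ifP => /= iA; last by rewrite big1.
  by apply: eq_bigr => j _; rewrite !inE negb_or eq_sym andbC.
- by move=> i; rewrite /G eqxx andbF.
- move=> i j; rewrite /G [(j \notin A) && _]andbC [j == i]eq_sym.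
  case: ifP => [/andP[/andP[iA jA] ne]|_]; last by rewrite oppr0.
  rewrite setUCA !koszul_signU1 //.
  have := sign_ltn ne; set s := _ ^+ _; set t := _ ^+ _ => st.
  have s2 : s * s = 1 by rewrite -expr2 sqrr_sign.
  have -> : t = - s by rewrite -[t]mul1r -s2 -mulrA st mulrN1.
  by ring.
Qed.

(** Multiplication by [x i] is null-homotopic. *)
Lemma koszul_homotopy i c A :
  koszul_diff (koszul_mul i c) A + koszul_mul i (koszul_diff c) A = x i * c A.
Proof.
rewrite {2}/koszul_mul; case: ifP => iA; last first.
  have {}iA := negbT iA.
  rewrite addr0 /koszul_diff (bigD1 i) //= big1 ?addr0 => [|j /andP[jA ne]].
    rewrite /koszul_mul setU11 setU1K //.
    by rewrite mulrACA koszul_sign_sqr mul1r.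
  by rewrite /koszul_mul !inE eq_sym (negbTE ne) (negbTE iA) mulr0.
set B := A :\ i; have iB : i \notin B by rewrite setD11.
have eA : i |: B = A by rewrite setD1K.
rewrite [X in _ + _ * X](bigD1 i) //= eA mulrDr addrCA mulrA mulrA.
rewrite koszul_sign_sqr mul1r.
rewrite -[RHS]addr0; congr (_ + _); rewrite mulr_sumr /koszul_diff.
rewrite (eq_bigl (fun j => (j \notin B) && (j != i))) => [|j]; last first.
  by rewrite -eA !inE negb_or andbC.
rewrite -big_split big1 //= => j /andP[jB ne].
rewrite /koszul_mul -eA !inE eqxx orbT setUCA setU1K; last first.
  by rewrite in_setU1 negb_or eq_sym ne.
rewrite !koszul_signU1 //.
have := sign_ltn ne; set s := _ ^+ _; set t := _ ^+ _ => st.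
rewrite [LHS](_ : _ = (s * t + 1) *
  (koszul_sign i B * koszul_sign j B * x j * c (j |: B))).
  by rewrite st addNr mul0r.
by ring.
Qed.

Lemma koszul_diffD c c' A :
  koszul_diff (fun B => c B + c' B) A = koszul_diff c A + koszul_diff c' A.
Proof. by rewrite -big_split; apply: eq_bigr => i _; rewrite mulrDr. Qed.

Lemma koszul_diffZ a c A : koszul_diff (fun B => a * c B) A = a * koszul_diff c A.
Proof. by rewrite mulr_sumr; apply: eq_bigr => i _; rewrite mulrCA. Qed.

Lemma koszul_diff_ideal (J : R -> Prop) c A : is_ideal J ->
  (forall B, J (c B)) -> J (koszul_diff c A).
Proof.
move=> [J0 JD JM] Jc; apply: (big_ind J) => // i _.
exact/JM/Jc.
Qed.

Lemma koszul_lift (J : R -> Prop) f z d : is_ideal J ->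
  ideal_gen (fun g => exists i, g = x i) f ->
  has_degree d z -> (forall A, J (koszul_diff z A)) ->
  exists2 w, has_degree d.+1 w & forall A, J (koszul_diff w A - f * z A).
Proof.
move=> JJ; have [J0 JD JM] := JJ => mf dz cyc; move: f mf.
apply: ideal_genP => [|_ [i ->]].
  split=> [|f g [w dw Jw] [w' dw' Jw']|a f [w dw Jw]].
  - exists (fun=> 0) => // A; rewrite mul0r subr0 /koszul_diff big1 // => i _.
    by rewrite mulr0.
  - exists (fun A => w A + w' A) => A; first by move=> ne; rewrite dw ?dw' ?addr0.
    rewrite koszul_diffD mulrDl opprD addrACA; exact: JD.
  - exists (fun A => a * w A) => A; first by move=> ne; rewrite dw ?mulr0.
    by rewrite koszul_diffZ -mulrA -mulrBr; apply: JM.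
exists (koszul_mul i z) => A.
  move=> ne; rewrite /koszul_mul; case: ifP => // iA; rewrite dz ?mulr0 //.
  by move: ne; rewrite (cardsD1 i A) iA add1n eqSS.
rewrite -koszul_homotopy opprD addrA subrr add0r /koszul_mul -mulN1r.
by apply: (JM); case: ifP => // _; apply: JM.
Qed.

(** Dividing by a regular element [f] shifts nonzero Koszul homology up by one:
    a cycle [z] lifts to [w] with [koszul_diff w = f * z] modulo [J], and [w]
    is a cycle modulo [J + (f)], which bounds there only if [z] bounds modulo
    [J]. There is nothing to shift into above degree [n]. *)
Lemma wregular_koszul_exact (J : R -> Prop) fs z d : is_ideal J ->
  wregular J fs -> (forall f, f \in fs -> ideal_gen (fun g => exists i, g = x i) f) ->
  has_degree d z -> (forall A, J (koszul_diff z A)) -> (n < d + size fs)%N ->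
  exists y, forall A, J (z A - koszul_diff y A).
Proof.
elim: fs J z d => [|f fs IH] J z d JJ reg mfs dz cyc ltn.
  have [J0 _ _] := JJ; exists (fun=> 0) => A.
  rewrite dz; last by have := max_card A; rewrite card_ord; move: ltn => /=; lia.
  by rewrite sub0r /koszul_diff big1 ?oppr0 // => i _; rewrite mulr0.
have [J0 JD JM] := JJ; case: reg => regf regfs.
have [w dw Jw] := koszul_lift JJ (mfs f (mem_head _ _)) dz cyc.
have [||||y Jy] := IH (adjoin J f) w d.+1 (ideal_adjoin1 f JJ) regfs.
- by move=> g gfs; apply: mfs; rewrite inE gfs orbT.
- exact: dw.
- by move=> A; exists (z A); rewrite [z A * f]mulrC.
- by move: ltn => /=; rewrite addnS addSn.
have [w' Jw'] := fin_all_exists Jy.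
exists w' => A; apply: regf.
have -> : f * (z A - koszul_diff w' A) =
    koszul_diff (fun B => w B - koszul_diff y B - w' B * f) A
    - (koszul_diff w A - f * z A).
  have -> : koszul_diff (fun B => w B - koszul_diff y B - w' B * f) A =
      koszul_diff w A + koszul_diff (fun B => -1 * koszul_diff y B) A
      + koszul_diff (fun B => - f * w' B) A.
    by rewrite -!koszul_diffD; apply: eq_bigr => i _; congr (_ * _); ring.
  by rewrite !koszul_diffZ koszul_diffK; ring.
by apply: idealB => //; apply: koszul_diff_ideal.
Qed.

End Koszul.

(** * Depth of squarefree monomial ideals *)

Section Depth.
Variables (K : fieldType) (n : nat).
Notation S := {mpoly K[n]}.
Implicit Types (N : pred {set 'I_n}) (A B C D F : {set 'I_n}).

Definition mset F : 'X_{1..n} := [multinom (i \in F : nat) | i < n].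

Lemma msupport_mset F : msupport (mset F) = F.
Proof. by apply/setP => i; rewrite inE mnmE eqb0 negbK. Qed.

Lemma msetU1 v F : v \notin F -> mset (v |: F) = (U_(v) + mset F)%MM.
Proof.
move=> vF; apply/mnmP => i; rewrite mnmDE !mnmE !inE.
by have [<-|] := eqVneq v i; rewrite ?(negbTE vF) ?eqxx // eq_sym => /negbTE->.
Qed.

Lemma depth_ge N r : upclosed N -> ~~ N set0 ->
  wregular (mono_ideal N) (complete_syms K n r) ->
  exists fs : seq S, [/\ forall f, f \in fs -> max_ideal f,
    regular_seq (mono_ideal N) fs & size fs = r].
Proof.
move=> upN N0 reg.
have m_syms f : f \in complete_syms K n r -> max_ideal f.
  move=> /mapP[j]; rewrite mem_iota => /andP[j0 _] ->.
  exact: max_ideal_complete_sym.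
exists (complete_syms K n r); split=> //; last by rewrite size_map size_iota.
apply/regular_seqE; first exact: ideal_mono.
by split=> //; apply: proper_adjoins_mono.
Qed.

(** The cycle [1] in Koszul degree [0] bounds only modulo an ideal that contains
    a polynomial with nonzero constant term. *)
Lemma regular_seq_size N (fs : seq S) : upclosed N -> ~~ N set0 ->
  (forall f, f \in fs -> max_ideal f) -> regular_seq (mono_ideal N) fs ->
  (size fs <= n)%N.
Proof.
move=> upN N0 mfs; have II := ideal_mono K upN.
move=> /(regular_seqE _ II)[reg _]; rewrite leqNgt; apply/negP => ltn.
pose z A : S := (A == set0)%:R.
have [|A|y Iy] := wregular_koszul_exact (z := z) (d := 0) II reg mfs _ _ ltn.
- by move=> A; rewrite cards_eq0 /z => /negbTE->.
- rewrite /koszul_diff big1 => [|i _]; first by have [] := II.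
  have /negbTE iA : i |: A != set0 by apply/set0Pn; exists i; rewrite setU11.
  rewrite /z iA.
  by rewrite mulr0.
have := Iy set0; rewrite /z eqxx => I1.
have : (1 - koszul_diff (fun i => 'X_i) y set0)@_0%MM = 0.
  by apply: contraNeq N0; rewrite -mcoeff_msupp => /I1; rewrite msupport0.
rewrite mcoeffB mcoeff1 eqxx /koszul_diff raddf_sum big1 ?subr0 => [/eqP|i _ /=].
  by rewrite oner_eq0.
by rewrite !rmorphM /= mcoeffX mnm1_eq0 mulr0 mul0r.
Qed.

(** The monomial of the facet [F], placed on the basis element of the complement
    of [F], is a Koszul cycle. It does not bound: its differential involves the
    monomial of the minimal nonface [v |: F], which is not in the product of the
    maximal ideal and the ideal. *)
Lemma regular_seq_facet N (fs : seq S) F v : upclosed N -> v \notin F ->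
  (forall i, i \notin F -> N (i |: F)) ->
  (forall B, #|B| = #|F| -> ~~ N B) ->
  (forall f, f \in fs -> max_ideal f) -> regular_seq (mono_ideal N) fs ->
  (size fs <= #|F|)%N.
Proof.
move=> upN vF facet faces mfs; have II := ideal_mono K upN.
have [I0 ID IM] := II.
move=> /(regular_seqE _ II)[reg _]; rewrite leqNgt; apply/negP => ltn.
pose z A : S := if A == ~: F then 'X_[mset F] else 0.
have cF : (#|F| + #|~: F| = n)%N by rewrite cardsC card_ord.
have [|A||y Iy] := wregular_koszul_exact (z := z) (d := #|~: F|) II reg mfs.
- by move=> A; rewrite /z; case: (A =P ~: F) => [->|//]; rewrite eqxx.
- apply: ideal_sum => // i iA; rewrite /z; case: eqP => [eA|_]; last by rewrite mulr0.
  have iF : i \notin F by rewrite -in_setC -eA setU11.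
  rewrite -mulrA -mpolyXD -msetU1 //; apply/IM/mem_mono_ideal.
  by rewrite msupport_mset; apply: facet.
- by move: ltn; rewrite -(ltn_add2r #|~: F|) cF addnC.
pose c A := z A - koszul_diff (fun i => 'X_i) y A.
pose B := v |: F; pose A := ~: B.
have dcz : koszul_diff (fun i => 'X_i) c A = koszul_diff (fun i => 'X_i) z A.
  rewrite -[RHS]subr0 -(koszul_diffK (fun i => 'X_i) y A) /koszul_diff -sumrB.
  by apply: eq_bigr => i _; rewrite mulrBr.
have : (koszul_diff (fun i => 'X_i) c A)@_(mset B) = 0.
  rewrite raddf_sum big1 // => i iA /=.
  have iB : i \in B by rewrite -[B]setCK inE.
  rewrite [_ * 'X_i]mulrC -mulrA mulrC -(setD1K iB) msetU1 ?setD11 // mcoeffMX.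
  apply/eqP; apply: contraT; rewrite -mcoeff_msupp => supp.
  have /IM/(_ _ supp) := Iy (i |: A); rewrite msupport_mset => NB.
  rewrite -(negbK (N _)) faces // in NB.
  by have := cardsD1 i B; rewrite iB /B cardsU1 vF => -[].
rewrite dcz /koszul_diff (bigD1 v) /=; last by rewrite !inE eqxx.
rewrite big1 ?addr0 => [|i /andP[_ ne]]; last first.
  rewrite /z; case: eqP => [eA|_]; last by rewrite mulr0.
  have : v \in ~: F by rewrite inE.
  by rewrite -eA !inE eqxx orbF eq_sym (negbTE ne).
have -> : v |: A = ~: F.
  by apply/setP => i; rewrite !inE negb_or; have [->|] := eqVneq i v.
rewrite /z eqxx -mulrA -mpolyXD -msetU1 // /koszul_sign -signr_odd.
by case: odd; rewrite ?expr1 ?mulN1r ?mul1r ?mcoeffN mcoeffX eqxx => /eqP;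
  rewrite ?oppr_eq0 oner_eq0.
Qed.

Lemma ex_maximum (P : nat -> Prop) b r : (forall d, P d -> (d <= b)%N) -> P r ->
  exists2 d, (r <= d)%N & P d /\ forall e, P e -> (e <= d)%N.
Proof.
move=> bound; have [k] := ubnP (b - r); elim: k r => // k IH r ltk Pr.
have [[e [lt Pe]]|none] := classic (exists e, (r < e)%N /\ P e).
  have lee := bound _ Pe.
  have [|d le Pd] := IH e _ Pe; first by lia.
  by exists d => //; apply: leq_trans le; apply: ltnW.
exists r => //; split=> // e Pe; rewrite leqNgt; apply/negP => lt.
by apply: none; exists e.
Qed.

Lemma ex_depth N r : upclosed N -> ~~ N set0 ->
  wregular (mono_ideal N) (complete_syms K n r) ->
  exists2 d, (r <= d)%N & is_depth (mono_ideal (K := K) N) d.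
Proof.
move=> upN N0 reg.
pose P d := exists fs : seq S, [/\ forall f, f \in fs -> max_ideal f,
  regular_seq (mono_ideal N) fs & size fs = d].
have [|d le [Pd maxd]] := @ex_maximum P n r _ (depth_ge upN N0 reg).
  by move=> _ [fs [mfs regs <-]]; apply: regular_seq_size regs.
by exists d => //; split=> // fs mfs regs; apply: maxd; exists fs.
Qed.

End Depth.

(** * Squarefree powers of edge ideals and matchings *)

Section Matchings.
Variables (n : nat) (G : sgraph n).
Implicit Types (s t : seq ('I_n * 'I_n)) (A B F : {set 'I_n}).

Definition endpoints s : seq 'I_n := flatten [seq [:: p.1; p.2] | p <- s].

Definition edge_seq s : bool := all (fun p => G p.1 p.2) s.

Definition has_matching k : pred {set 'I_n} := fun A =>
  [exists t : k.-tuple ('I_n * 'I_n),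
     [&& edge_seq t, uniq (endpoints t) & all (fun v => v \in A) (endpoints t)]].

Lemma has_matchingP k A : reflect
  (exists s, [/\ size s = k, edge_seq s, uniq (endpoints s)
               & {subset endpoints s <= A}])
  (has_matching k A).
Proof.
apply: (iffP existsP) => [[t /and3P[Gt ut /allP sA]]|[s [sk Gs us sA]]].
  by exists t; rewrite size_tuple.
by move/eqP: sk => sk; exists (Tuple sk); apply/and3P; split=> //; apply/allP.
Qed.

Lemma size_endpoints s : size (endpoints s) = (2 * size s)%N.
Proof. by elim: s => //= p s IH; rewrite IH mulnS. Qed.

Lemma endpoints_cat s t : endpoints (s ++ t) = endpoints s ++ endpoints t.
Proof. by rewrite /endpoints map_cat flatten_cat. Qed.

Lemma mem_endpoints s v :
  reflect (exists2 p, p \in s & v \in [:: p.1; p.2]) (v \in endpoints s).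
Proof. exact: flatten_mapP. Qed.

Lemma upclosed_matching k : upclosed (has_matching k).
Proof.
move=> A B /subsetP sAB /has_matchingP[s [sk Gs us sA]]; apply/has_matchingP.
by exists s; split=> // v /sA/sAB.
Qed.

Lemma has_matching_card k A : has_matching k A -> (2 * k <= #|A|)%N.
Proof.
move=> /has_matchingP[s [<- Gs us sA]]; rewrite -size_endpoints cardE.
by apply: uniq_leq_size => // v /sA; rewrite mem_enum.
Qed.

(** Every edge at [y] ends in [x], so that no matching avoiding [x] can
    use [y]. *)
Lemma has_matching_isolated_edge k A x y : (forall z, G y z -> z = x) ->
  x \notin A -> has_matching k A -> has_matching k (A :\ y).
Proof.
move=> nbr xA /has_matchingP[s [sk Gs us sA]]; apply/has_matchingP.
exists s; split=> // v vs; rewrite !inE (sA _ vs) andbT.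
apply: contra xA => /eqP vy; rewrite {v}vy in vs.
case/mem_endpoints: vs => -[a b] ps /=.
have /= Gab := allP Gs _ ps; rewrite !inE => /orP[]/eqP yE; rewrite -yE in Gab.
  rewrite -(nbr _ Gab); apply/sA/mem_endpoints; exists (a, b) => //=.
  by rewrite !inE eqxx orbT.
rewrite adj_sym in Gab; rewrite -(nbr _ Gab).
by apply/sA/mem_endpoints; exists (a, b) => //=; rewrite !inE eqxx.
Qed.

Lemma uniq_endpoints s : uniq (endpoints s) -> uniq s /\
  forall p q v, p \in s -> q \in s ->
    v \in [:: p.1; p.2] -> v \in [:: q.1; q.2] -> p = q.
Proof.
elim: s => [|r s IH]; first by split.
rewrite /endpoints [flatten _]/= -[_ :: _ :: _]/([:: r.1; r.2] ++ endpoints s).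
rewrite cat_uniq => /and3P[ur /hasPn disj /IH[us inj]].
have sep p v : p \in s -> v \in [:: p.1; p.2] -> v \notin [:: r.1; r.2].
  by move=> ps vp; apply/disj/mem_endpoints; exists p.
split=> [|p q v].
  by rewrite /= us andbT; apply/negP => /sep/(_ (mem_head _ _)); rewrite mem_head.
rewrite [p \in _]in_cons [q \in _]in_cons.
case/predU1P=> [->|ps] /predU1P[->|qs] // vp vq.
- by have := sep _ v qs vq; rewrite vp.
- by have := sep _ v ps vp; rewrite vq.
- exact: (inj p q v).
Qed.

Lemma matching_numberE k : has_matching k setT -> (n <= (2 * k).+1)%N ->
  matching_number G = k.
Proof.
move=> /has_matchingP[s [sk Gs us _]] le_n; have [us' inj] := uniq_endpoints us.
apply/eqP; rewrite eqn_leq; apply/andP; split.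
  apply/bigmax_leqP => M /andP[/subsetP sM /eqP triv].
  have : (\sum_(e in M) #|e| = 2 * #|M|)%N.
    rewrite mulnC -sum_nat_const; apply: eq_bigr => e /sM/imsetP[[a b] /=].
    rewrite inE /= => Gab ->; rewrite cards2; case: eqVneq => // ab.
    by rewrite ab adj_irr in Gab.
  have : (#|cover M| <= n)%N by rewrite -[leqRHS]card_ord max_card.
  by rewrite triv => /[swap] ->; lia.
pose edge (p : 'I_n * 'I_n) := [set p.1; p.2].
have memE p v : (v \in edge p) = (v \in [:: p.1; p.2]) by rewrite !inE.
pose M := [set edge p | p in s].
have -> : k = #|M|.
  rewrite card_in_imset ?(card_uniqP us') // => p q ps qs epq.
  by apply: (inj p q p.1); rewrite // -?memE -?epq ?memE ?mem_head.
apply: leq_bigmax_cond; apply/andP; split.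
  apply/subsetP => _ /imsetP[p ps ->]; apply: imset_f.
  by rewrite inE; apply: (allP Gs).
apply/trivIsetP => _ _ /imsetP[p ps ->] /imsetP[q qs ->].
apply: contraR => /pred0Pn[v /= /andP[]]; rewrite !memE => vp vq.
by rewrite (inj p q v).
Qed.

End Matchings.

Section SquarefreePowers.
Variables (K : fieldType) (n : nat) (G : sgraph n).
Notation S := {mpoly K[n]}.
Implicit Types (s t : seq ('I_n * 'I_n)) (A B F : {set 'I_n}).

Definition above_edges k (a : 'X_{1..n}) : Prop :=
  exists s, [/\ size s = k, edge_seq G s
              & forall v, (count_mem v (endpoints s) <= a v)%N].

Definition edge_monomials k (f : S) : Prop :=
  forall a, a \in msupp f -> above_edges k a.

Lemma ideal_edge_monomials k : is_ideal (edge_monomials k).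
Proof.
split; first by move=> a; rewrite msupp0.
  by move=> f g If Ig a /msuppD_le; rewrite mem_cat => /orP[/If|/Ig].
move=> c f If a /msuppM_le/allpairsP[[x y] [/= _ /If[s [sk Gs cs]] ->]].
by exists s; split=> // v; rewrite mnmDE; apply: leq_trans (cs v) (leq_addl _ _).
Qed.

Lemma edge_monomialsM k l f g :
  edge_monomials k f -> edge_monomials l g -> edge_monomials (k + l) (f * g).
Proof.
move=> If Ig a /msuppM_le/allpairsP[[x y] [/= /If[s [sk Gs cs]] /Ig[t [tl Gt ct]] ->]].
exists (s ++ t); rewrite size_cat sk tl /edge_seq all_cat -!/(edge_seq _ _) Gs Gt.
by split=> // v; rewrite endpoints_cat count_cat mnmDE leq_add.
Qed.

Lemma edge_ideal_monomials f : edge_ideal G K f -> edge_monomials 1 f.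
Proof.
apply: ideal_genP; first exact: ideal_edge_monomials.
move=> _ [i [j [Gij ->]]] a; rewrite -mpolyXD msuppX inE => /eqP->.
exists [:: (i, j)]; rewrite /edge_seq /= Gij; split=> // v.
by rewrite /= mnmDE !mnm1E addn0.
Qed.

Lemma edge_ideal_pow_monomials k f :
  ideal_pow (edge_ideal G K) k f -> edge_monomials k f.
Proof.
apply: ideal_genP; first exact: ideal_edge_monomials.
move=> _ [g Ig ->]; elim: k g Ig => [|k IH] g Ig.
  by rewrite big_ord0 => a _; exists [::].
rewrite big_ord_recl; apply: (@edge_monomialsM 1 k).
  exact/edge_ideal_monomials/Ig.
by apply: IH => i; apply: Ig.
Qed.

(** The squarefree monomials in the [k]-th power are those divisible by the
    product of [k] edges; squarefreeness forces these edges to be disjoint. *)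
Lemma squarefree_pow_edge_ideal k :
  squarefree_pow (edge_ideal G K) k = mono_ideal (has_matching G k).
Proof.
have upN := upclosed_matching (G := G) (k := k).
apply: functional_extensionality => f; apply: propositional_extensionality.
split; move: f.
  apply: ideal_genP; first exact: ideal_mono.
  move=> _ [a [sqf pow ->]]; apply/mem_mono_ideal.
  have [|s [sk Gs cs]] := edge_ideal_pow_monomials pow (a := a).
    by rewrite msuppX mem_head.
  have le1 v : (count_mem v (endpoints s) <= 1)%N := leq_trans (cs v) (sqf v).
  apply/has_matchingP; exists s; split=> //.
    apply: count_mem_uniq => v; have := le1 v; rewrite -has_pred1 has_count.
    by case: (count _ _) => [|[]].
  by move=> v; rewrite -has_pred1 has_count inE -lt0n => /leq_trans; apply.
move=> f Nf; have II := ideal_ideal_gen (fun g : S => exists a : 'X_{1..n},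
  [/\ squarefree_mnm a, ideal_pow (edge_ideal G K) k 'X_[a] & g = 'X_[a]]).
have [_ _ IM] := II; rewrite [f]mpolyE big_seq_cond.
apply: (ideal_sum _ II) => a /andP[/Nf/existsP[t /and3P[Gt ut /allP tA]] _].
pose b : 'X_{1..n} := (\sum_(p <- t) (U_(p.1) + U_(p.2)))%MM.
have bE v : b v = count_mem v (endpoints t).
  rewrite /b /endpoints; elim: (tval t) => [|p s IH].
    by rewrite big_nil mnm0E.
  by rewrite big_cons mnmDE IH /= mnmDE !mnm1E addnA.
have ba : (b <= a)%MM.
  apply/mnm_lepP => v; rewrite bE count_uniq_mem //.
  by case: (boolP (v \in _)) => // /tA; rewrite inE lt0n.
rewrite -mul_mpolyC -(submK ba) mpolyXD mulrA; apply/IM/mem_ideal_gen.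
exists b; split=> //; first by move=> v; rewrite bE count_uniq_mem // leq_b1.
apply: mem_ideal_gen; exists (fun i => 'X_(tnth t i).1 * 'X_(tnth t i).2).
  move=> i; apply: mem_ideal_gen; exists (tnth t i).1, (tnth t i).2; split=> //.
  exact/(allP Gt)/mem_tnth.
rewrite /b -mprodXE big_tuple.
by apply: eq_bigr => i _; rewrite mpolyXD.
Qed.

Lemma indeg_squarefree_pow k A : has_matching G k A -> #|A| = (2 * k)%N ->
  is_indeg (squarefree_pow (edge_ideal G K) k) (2 * k).
Proof.
move=> mA cA; rewrite squarefree_pow_edge_ideal.
have card_le (a : 'X_{1..n}) : (#|msupport a| <= mdeg a)%N.
  rewrite mdegE -sum1_card big_mkcond; apply: leq_sum => i _.
  by rewrite inE; case: eqP => //; rewrite lt0n => /eqP.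
split=> [|a [/mem_mono_ideal/has_matching_card le _]]; last first.
  exact: leq_trans le (card_le a).
exists (mset A); last first.
  rewrite mdegE -cA -sum1_card [RHS]big_mkcond; apply: eq_bigr => i _.
  by rewrite mnmE; case: (i \in A).
split; first by apply/mem_mono_ideal; rewrite msupport_mset.
move=> b /mem_mono_ideal/has_matching_card le /mnm_lepP leb.
have subA : msupport b \subset A.
  apply/subsetP => i; rewrite inE -lt0n => /leq_trans/(_ (leb i)).
  by rewrite mnmE; case: (i \in A).
have {subA le} eqA : msupport b = A by apply/eqP; rewrite eqEcard subA cA.
apply/mnmP => i; apply/eqP; rewrite eqn_leq leb mnmE -eqA inE.
by case: eqP => // /eqP; rewrite -lt0n.
Qed.

End SquarefreePowers.

(** * Disjoint edges next to a complete graph *)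

Section EdgesAndClique.
Variables (s m : nat).
Hypothesis lt_sm : (s < m)%N.

(* The number of vertices is [2m], written as a successor for [inord]. *)
Notation n := (2 * m).-1.+1.
Notation vertex := 'I_n.
Implicit Types (A B C D F : {set vertex}) (x y z v : vertex).

(** The edges [{2j, 2j + 1}] for [j < s], and a complete graph on the vertices
    from [2s] on. *)
Definition edges_clique_adj : rel vertex := fun x y =>
  (x != y) && ((x %/ 2 == y %/ 2)%N || ((2 * s <= x)%N && (2 * s <= y)%N)).

Lemma edges_clique_sym : ssrbool.symmetric edges_clique_adj.
Proof.
move=> x y; rewrite /edges_clique_adj eq_sym [(x %/ 2 == _)%N]eq_sym.
by rewrite [X in _ || X]andbC.
Qed.

Lemma edges_clique_irr : irreflexive edges_clique_adj.
Proof. by move=> x; rewrite /edges_clique_adj eqxx. Qed.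

Definition edges_clique : sgraph n := SGraph edges_clique_sym edges_clique_irr.

Definition initial_segment c : {set vertex} := [set v : vertex | (v < c)%N].

Lemma card_vertex : n = (2 * m)%N.
Proof. by lia. Qed.

Lemma card_initial_segment c : (c <= 2 * m)%N -> #|initial_segment c| = c.
Proof.
move=> lec; have le : (c <= n)%N by rewrite card_vertex.
rewrite -sum1_card (eq_bigl (fun v : vertex => (v < c)%N)) => [|v]; last by rewrite inE.
by rewrite (big_ord_narrow le) sum1_card card_ord.
Qed.

Lemma vertexK i : (i < 2 * m)%N -> (inord i : vertex) = i :> nat.
Proof. by move=> lt; apply: inordK; rewrite card_vertex. Qed.

Definition first_edges k : seq (vertex * vertex) :=
  [seq (inord (2 * j), inord (2 * j).+1) | j <- iota 0 k].

Lemma endpoints_first_edges k :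
  endpoints (first_edges k) = [seq inord i | i <- iota 0 (2 * k)].
Proof.
suff gen a : endpoints [seq (inord (2 * j), inord (2 * j).+1) | j <- iota a k]
    = [seq inord i : vertex | i <- iota (2 * a) (2 * k)] by exact: (gen 0%N).
elim: k a => [|k IH] a //.
by rewrite mulnS /= /endpoints /= -/(endpoints _) IH mulnS.
Qed.

Lemma edge_first_edges k : (k <= m)%N -> edge_seq edges_clique (first_edges k).
Proof.
move=> le; apply/allP => p /mapP[j]; rewrite mem_iota => /andP[_ lt] {p}-> /=.
rewrite /edges_clique_adj -val_eqE /= !vertexK; lia.
Qed.

Lemma uniq_first_edges k : (k <= m)%N -> uniq (endpoints (first_edges k)).
Proof.
move=> le; rewrite endpoints_first_edges map_inj_in_uniq ?iota_uniq // => i j.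
rewrite !mem_iota => /andP[_ lti] /andP[_ ltj] /(congr1 val) /=.
by rewrite !vertexK //; lia.
Qed.

Lemma mem_first_edges k v : (k <= m)%N ->
  v \in endpoints (first_edges k) -> (v < 2 * k)%N.
Proof.
move=> le; rewrite endpoints_first_edges => /mapP[i].
by rewrite mem_iota => /andP[_ lt] ->; rewrite vertexK //; lia.
Qed.

Lemma has_matching_segment k : (k <= m)%N ->
  has_matching edges_clique k (initial_segment (2 * k)).
Proof.
move=> le; apply/has_matchingP; exists (first_edges k); split.
- by rewrite size_map size_iota.
- exact: edge_first_edges.
- exact: uniq_first_edges.
- by move=> v /(mem_first_edges le) lt; rewrite inE.
Qed.

Lemma no_isolated_edges_clique : no_isolated edges_clique.
Proof.
move=> x; have ltx : (x < 2 * m)%N := leq_trans (ltn_ord x) (eq_leq card_vertex).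
have x2 := divn_eq x 2; have x2' : (x %% 2 < 2)%N by rewrite ltn_mod.
exists (inord (if (x %% 2 == 0)%N then x.+1 else x.-1)).
rewrite /= /edges_clique_adj -val_eqE /=.
by case: ((x %% 2)%N =P 0%N) => e; rewrite vertexK; lia.
Qed.

Lemma matching_number_edges_clique : matching_number edges_clique = m.
Proof.
apply: matching_numberE; last by lia.
by apply: upclosed_matching (has_matching_segment (leqnn m)).
Qed.

(** The edges [{2j, 2j + 1}] pair off the first [2k - 2] vertices; as [k > s], the
    remaining vertex [2k - 2] and [v] both lie in the complete graph. *)
Lemma segment_facet k v : (s < k <= m)%N -> v \notin initial_segment (2 * k).-1 ->
  has_matching edges_clique k (v |: initial_segment (2 * k).-1).
Proof.
move=> /andP[lt le]; rewrite inE -leqNgt => gev.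
have le' : (k.-1 <= m)%N by lia.
have ltv : (v < 2 * m)%N := leq_trans (ltn_ord v) (eq_leq card_vertex).
pose u : vertex := inord (2 * k).-2.
have uE : u = (2 * k).-2 :> nat by rewrite vertexK //; lia.
apply/has_matchingP; exists ((u, v) :: first_edges k.-1); split.
- by rewrite /= size_map size_iota; lia.
- apply/andP; split; last exact: edge_first_edges.
  by rewrite /= /edges_clique_adj -val_eqE /= uE; lia.
- rewrite /endpoints /= -/(endpoints _) uniq_first_edges // !inE negb_or.
  rewrite -val_eqE /= uE andbT -andbA; apply/and3P; split; first by lia.
    by apply/negP => /(mem_first_edges le'); rewrite uE; lia.
  by apply/negP => /(mem_first_edges le'); lia.
- move=> w; rewrite /endpoints /= -/(endpoints _) !inE => /or3P[/eqP->|->//|].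
    by rewrite uE; apply/orP; right; lia.
  by move=> /(mem_first_edges le') ltw; apply/orP; right; lia.
Qed.

Lemma matching_set0 k : (0 < k)%N -> ~~ has_matching edges_clique k set0.
Proof. by move=> k0; apply/negP => /has_matching_card; rewrite cards0; lia. Qed.

Lemma small_not_matching k F : (#|F| < 2 * k)%N -> ~~ has_matching edges_clique k F.
Proof. by rewrite ltnNge; apply/contra/has_matching_card. Qed.

Variable K : fieldType.

Lemma wregular_below_indeg k : (0 < k <= m)%N ->
  wregular (mono_ideal (K := K) (has_matching edges_clique k))
    (complete_syms K n (2 * k).-1).
Proof.
move=> /andP[k0 le].
apply: (eq_wregular_mono (N := fun A =>
  has_matching edges_clique k (A :|: set0) || meets set0 A)).
  by move=> A; rewrite setU0 /meets setI0 eqxx orbF.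
apply: wregular_faces; first exact: upclosed_matching.
- by rewrite -setI_eq0 set0I.
- by rewrite cards0 card_vertex; lia.
- by move=> F _ _ cF; apply: small_not_matching; rewrite cF; lia.
Qed.

Lemma isolated_edge j x y : (j < s)%N ->
  (x = (2 * j)%N :> nat /\ y = (2 * j).+1 :> nat) \/
  (y = (2 * j)%N :> nat /\ x = (2 * j).+1 :> nat) ->
  forall z, edges_clique y z -> z = x.
Proof.
move=> lt xy z /=; rewrite /edges_clique_adj -val_eqE /= => yz.
have yz' := divn_eq z 2; have z2 : (z %% 2 < 2)%N by rewrite ltn_mod.
apply: val_inj => /=; move: xy; lia.
Qed.

(** If one end [x] of an isolated edge [xy] is deleted, no matching uses [y]: a
    set of [2k] vertices that contains [y] but not [x] is then a face, and
    [wregular_faces] yields one regular element more than the size of the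
    generators alone. If both ends are linked, an edge is gained, and after [k]
    such steps the ideal is the unit ideal. *)
Lemma wregular_isolated_edges k : (0 < k <= s)%N ->
  wregular (mono_ideal (K := K) (has_matching edges_clique k))
    (complete_syms K n (2 * k)).
Proof.
move=> /andP[k0 le]; pose N := has_matching edges_clique k.
have upN : upclosed N by apply: upclosed_matching.
pose C j := initial_segment (2 * j).
have upNC (X : {set vertex}) : upclosed (fun A => N (A :|: X)).
  by move=> A B sAB; apply: upN; apply: setSU.
suff main i : (i <= k)%N ->
    wregular (mono_ideal (K := K) (fun A => N (A :|: C (k - i)%N)))
      (complete_syms K n (2 * k)).
  have := main k (leqnn k); rewrite subnn; apply: eq_wregular_mono => A.
  have -> : C 0%N = set0 by apply/setP => v; rewrite !inE.
  by rewrite setU0.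
have deleted x y j : (j < s)%N ->
    (x = (2 * j)%N :> nat /\ y = (2 * j).+1 :> nat) \/
    (y = (2 * j)%N :> nat /\ x = (2 * j).+1 :> nat) ->
    wregular (mono_ideal (K := K)
        (fun A => N (A :|: (y |: C j)) || meets [set x] A))
      (complete_syms K n (2 * k)).
  move=> lt xy; apply: wregular_faces => //.
  - rewrite disjoint_sym disjoints1 !inE negb_or -val_eqE /=; lia.
  - by rewrite cards1 card_vertex; lia.
  - move=> F /subsetP sF; rewrite disjoint_sym disjoints1 => xF cF.
    apply/negP => /(has_matching_isolated_edge (isolated_edge lt xy) xF).
    apply/negP/small_not_matching; have := cardsD1 y F.
    by rewrite (sF y) ?setU11 // cF add1n => ->.
elim: i => [|i IH] lei.
  apply: wregular_true => f a _; rewrite subn0.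
  by apply: upN (has_matching_segment _); [apply: subsetUr|lia].
set j := (k - i.+1)%N.
have ltj : (j < s)%N by rewrite /j; lia.
pose x : vertex := inord (2 * j); pose y : vertex := inord (2 * j).+1.
have xE : x = (2 * j)%N :> nat by rewrite vertexK //; lia.
have yE : y = (2 * j).+1 :> nat by rewrite vertexK //; lia.
apply: (wregular_branch (v := x)) => //.
  apply: (wregular_branch (v := y)).
  - by move=> A B sAB; apply: upN; rewrite setSU // setUS.
  - apply: eq_wregular_mono (IH (ltnW lei)) => A; congr N.
    apply/setP => v; rewrite !inE -!val_eqE /= xE yE.
    have -> : (k - i = j.+1)%N by rewrite /j; lia.
    by case: (v \in A) => /=; rewrite ?orbT //; lia.
  - apply: eq_wregular_mono (deleted y x j ltj _); last by right.
    move=> A; rewrite /meets setI_eq0 disjoint_sym disjoints1 negbK.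
    by rewrite setUCA setUA.
apply: eq_wregular_mono (deleted x y j ltj _); last by left.
move=> A; rewrite /meets setI_eq0 disjoint_sym disjoints1 negbK.
have [xA|xA] := boolP (x \in A); rewrite ?orbT // !orbF.
apply/idP/idP; last by apply: upN; rewrite setUS // subsetUr.
have nbr := isolated_edge ltj (or_introl (conj xE yE)).
move=> /(has_matching_isolated_edge nbr) H; apply: upN (H _).
  by apply/subsetP => v; rewrite !inE; case: (v == y).
by rewrite !inE (negbTE xA) -val_eqE /= xE yE; lia.
Qed.

Lemma normalized_depth_edges_clique k : (1 <= k <= m)%N ->
  exists g : int, normalized_depth (edge_ideal edges_clique K) k g /\
    (g = 0 <-> (s.+1 <= k <= m)%N).
Proof.
move=> lek; have /andP[k0 le] := lek.
have upN := @upclosed_matching _ edges_clique k.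
have N0 := matching_set0 k0.
have c2k : #|initial_segment (2 * k)| = (2 * k)%N by apply: card_initial_segment; lia.
have indeg := indeg_squarefree_pow K (has_matching_segment le) c2k.
have [ltsk|leks] := ltnP s k; last first.
  have [|d led depth] := ex_depth upN N0 (wregular_isolated_edges (k := k) _).
    by rewrite k0.
  exists (d%:Z - ((2 * k)%N%:Z - 1)); split; last by lia.
  by exists d, (2 * k)%N; split=> //; rewrite squarefree_pow_edge_ideal.
have [fs [mfs regs sz]] := depth_ge upN N0 (wregular_below_indeg lek).
exists 0; split; last by rewrite le.
exists (2 * k).-1, (2 * k)%N; split=> //; last by lia.
rewrite squarefree_pow_edge_ideal; split; first by exists fs.
have cF : #|initial_segment (2 * k).-1| = (2 * k).-1.
  by apply: card_initial_segment; lia.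
move=> gs mgs reggs; rewrite -[leqRHS]cF.
apply: (regular_seq_facet (v := inord (2 * k).-1)) upN _ _ _ mgs reggs.
- by rewrite inE vertexK ?ltnn //; lia.
- by move=> i iF; apply: segment_facet; rewrite ?ltsk.
- by move=> B cB; apply: small_not_matching; rewrite cB cF; lia.
Qed.

End EdgesAndClique.

Theorem theorem3p10 (K : fieldType) (s m : nat) (hs : (0 < s)%N) (hsm : (s < m)%N) :
  exists (n : nat) (G : sgraph n),
    [/\ no_isolated G,
        matching_number G = m
      & exists g : nat -> int,
          forall k : nat, (1 <= k <= m)%N ->
            normalized_depth (edge_ideal G K) k (g k) /\
            (g k = 0%R <-> (s.+1 <= k <= m)%N)].
Proof.
exists (2 * m).-1.+1, (edges_clique s m); split.
- exact: no_isolated_edges_clique.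
- exact: matching_number_edges_clique.
have [i|g Hg] := @fin_all_exists 'I_m.+1 (fun=> int) (fun k g => (1 <= k <= m)%N ->
  normalized_depth (edge_ideal (edges_clique s m) K) k g /\
  (g = 0 <-> (s.+1 <= k <= m)%N)).
  have [lei|_] := boolP (1 <= i <= m)%N; last by exists 0.
  by have [g Hg] := normalized_depth_edges_clique hsm K lei; exists g.
exists (fun k => g (inord k)) => k lek.
by have := Hg (inord k); rewrite inordK ?ltnS; [apply|case/andP: lek].
Qed.
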